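(* The queue-length stationary distribution is invariant with respect to all coherent systems: for every coherent combination of scheduling rule and observation epoch, with observed long-run frequencies $\pi'(n)$ and actual long-run frequencies $\pi(n)$ (the limits being assumed to exist and $\pi$ to be a proper probability distribution), the distributions $\{\pi'(n)\}_{n\ge0}$ and $\{\pi(n)\}_{n\ge0}$ are identical.
   Context: Time is discrete, $\tau=0,1,2,\dots$. In the actual system customer $k\ge1$ arrives at the integer $A_k$ and departs at the integer $D_k$, where $0\le A_k\le A_{k+1}$, $A_k\to\infty$, and $D_k\ge A_k+1$ (service times are at least one). The actual waiting time (time in system) is $W_k=D_k-A_k$, and the actual number in system is $L(\tau)=\#\{k:A_k<\tau\le D_k\}$. Near each integer $\tau$ there are instants $\tau^{--}<\tau^-<\tau<\tau^+$ infinitesimally close to $\tau$ (formally $\tau-2\varepsilon,\ \tau-\varepsilon,\ \tau,\ \tau+\varepsilon$ with a fixed $0<\varepsilon<1/8$). A scheduling rule replaces $A_k,D_k$ by scheduled instants $A'_k,D'_k$ located as follows. EAS: $A'_k\in(A_k,A_k^+)$, $D'_k\in(D_k^-,D_k)$. LAS-IA: $A'_k\in(A_k^-,A_k)$, $D'_k\in(D_k-1,(D_k-1)^+)$. LAS-DA: $A'_k\in(A_k^-,A_k)$, $D'_k\in(D_k,D_k^+)$. LA-AF: $A'_k\in(A_k^{--},A_k^-)$, $D'_k\in(D_k^-,D_k)$. LA-DF: $A'_k\in(A_k^-,A_k)$, $D'_k\in(D_k^{--},D_k^-)$. The observation epoch $u(\tau)$ is one of: random observer, $u(\tau)=\tau$;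 outside observer, $u(\tau)=\tau-0.5$; or the potential pre-arrival, post-arrival, pre-departure, post-departure epochs, which are respectively $\tau,\tau^+,\tau^-,\tau$ for EAS; $\tau^-,\tau,\tau,\tau^+$ for LAS-IA and LAS-DA; $\tau^{--},\tau^-,\tau^-,\tau$ for LA-AF; $\tau^-,\tau,\tau^{--},\tau^-$ for LA-DF. The observed waiting time is $W^o_k=\sum_{\tau=0}^\infty \mathbf 1\{A'_k<u(\tau)\le D'_k\}$ and the observed number in system is $L(u(\tau))=\#\{k:A'_k<u(\tau)\le D'_k\}$. The system is coherent if $W^o_k=W_k$ for all $k\ge1$. The observed and actual long-run frequencies of state $n$ are $$\pi'(n)=\lim_{\tau\to\infty}\frac1\tau\sum_{j=1}^\tau\mathbf 1\{L(u(j))=n\},\qquad \pi(n)=\lim_{\tau\to\infty}\frac1\tau\sum_{j=1}^\tau\mathbf 1\{L(j)=n\}.$$ *)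

(* Defs.v *)
From HB Require Import structures.
From mathcomp Require Import all_boot all_order all_algebra.
From mathcomp Require Import all_classical all_reals all_analysis.

Set Implicit Arguments.
Unset Strict Implicit.
Unset Printing Implicit Defensive.

Import Order.TTheory GRing.Theory Num.Theory.
Import numFieldNormedType.Exports.

Local Open Scope classical_set_scope.
Local Open Scope ring_scope.

Inductive scheduling_rule := EAS | LAS_IA | LAS_DA | LA_AF | LA_DF.

Inductive observation_epoch :=
  | RandomObserver
  | OutsideObserver
  | PreArrival
  | PostArrival
  | PreDeparture
  | PostDeparture.

(* Customers are numbered from 1: the values A 0 and D 0 are irrelevant. *)
Record arrival_departure_path (A D : nat -> nat) : Prop := {
  arrivals_ordered : forall k, (1 <= k)%N -> (A k <= A k.+1)%N;
  arrivals_diverge : A @ \oo --> \oo;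
  service_ge1 : forall k, (1 <= k)%N -> (A k + 1 <= D k)%N
}.

Section Instants.
Context {R : realType}.
Variable eps : R.

Definition instant_mm (t : R) : R := t - 2 * eps.
Definition instant_m (t : R) : R := t - eps.
Definition instant_p (t : R) : R := t + eps.

Definition scheduled_arrival (r : scheduling_rule) (a a' : R) : Prop :=
  match r with
  | EAS => a < a' < instant_p a
  | LAS_IA | LAS_DA | LA_DF => instant_m a < a' < a
  | LA_AF => instant_mm a < a' < instant_m a
  end.

Definition scheduled_departure (r : scheduling_rule) (d d' : R) : Prop :=
  match r with
  | EAS | LA_AF => instant_m d < d' < d
  | LAS_IA => d - 1 < d' < instant_p (d - 1)
  | LAS_DA => d < d' < instant_p d
  | LA_DF => instant_mm d < d' < instant_m d
  end.

Definition scheduled (r : scheduling_rule) (A D : nat -> nat)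
    (A' D' : nat -> R) : Prop :=
  forall k, (1 <= k)%N ->
    scheduled_arrival r (A k)%:R (A' k) /\
    scheduled_departure r (D k)%:R (D' k).

Definition epoch (r : scheduling_rule) (o : observation_epoch) (tau : nat) : R :=
  let t : R := tau%:R in
  match o, r with
  | RandomObserver, _ => t
  | OutsideObserver, _ => t - 2^-1
  | PreArrival, EAS => t
  | PreArrival, (LAS_IA | LAS_DA) => instant_m t
  | PreArrival, LA_AF => instant_mm t
  | PreArrival, LA_DF => instant_m t
  | PostArrival, EAS => instant_p t
  | PostArrival, (LAS_IA | LAS_DA) => t
  | PostArrival, LA_AF => instant_m t
  | PostArrival, LA_DF => t
  | PreDeparture, EAS => instant_m t
  | PreDeparture, (LAS_IA | LAS_DA) => t
  | PreDeparture, LA_AF => instant_m t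
  | PreDeparture, LA_DF => instant_mm t
  | PostDeparture, EAS => t
  | PostDeparture, (LAS_IA | LAS_DA) => instant_p t
  | PostDeparture, LA_AF => t
  | PostDeparture, LA_DF => instant_m t
  end.

End Instants.

Section Observation.
Context {R : realType}.

Definition actual_wait (A D : nat -> nat) (k : nat) : R :=
  (D k)%:R - (A k)%:R.

Definition observed_wait (u : nat -> R) (A' D' : nat -> R) (k : nat) : \bar R :=
  (\sum_(0 <= tau <oo) (((A' k < u tau <= D' k)%R)%:R)%:E)%E.

Definition coherent (u : nat -> R) (A D : nat -> nat) (A' D' : nat -> R) : Prop :=
  forall k, (1 <= k)%N -> observed_wait u A' D' k = (actual_wait A D k)%:E.

(* [counting] is +oo on infinite sets, so that an infinite number in system
   would never be confused with a finite state. *)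
Definition number_in_system (A' D' : nat -> R) (t : R) : \bar R :=
  counting [set k : nat | (1 <= k)%N /\ A' k < t <= D' k].

Definition actual_number (A D : nat -> nat) (tau : nat) : \bar R :=
  number_in_system (fun k => (A k)%:R) (fun k => (D k)%:R) tau%:R.

Definition observed_number (u : nat -> R) (A' D' : nat -> R) (tau : nat) : \bar R :=
  number_in_system A' D' (u tau).

Definition frequency (L : nat -> \bar R) (n tau : nat) : R :=
  tau%:R^-1 * \sum_(1 <= j < tau.+1) (L j == n%:R%:E)%:R.

Definition long_run_frequencies (L : nat -> \bar R) (p : nat -> R) : Prop :=
  forall n, frequency L n @ \oo --> p n.

Definition proper_distribution (p : nat -> R) : Prop :=
  (forall n, 0 <= p n) /\ (\sum_(0 <= n <oo) (p n)%:E)%E = 1%E.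

End Observation.

(* Main.v *)
Require Import Defs.
From mathcomp Require Import all_boot all_order all_algebra.
From mathcomp Require Import all_classical all_reals all_analysis.
From mathcomp Require Import lra zify.

Import Order.TTheory GRing.Theory Num.Theory.
Import numFieldNormedType.Exports.

Local Open Scope classical_set_scope.
Local Open Scope ring_scope.

(** Scheduled instants and observation epochs all sit within a fixed grid
    around the integers: an epoch is always a grid point, a scheduled instant
    always lies strictly between two neighbouring grid points.  Hence comparing
    a scheduled instant with [u(tau)] does not depend on where in its interval
    the instant lies, and amounts to comparing integers: for each rule and
    epoch there are constants [b] and [c] with [A'_k < u(tau)] iff
    [A_k < tau + b], and [u(tau) <= D'_k] iff [tau + c <= D_k]
    ([arrival_observed], [departure_observed]).

    Customer [k] is therefore seen at [D_k - A_k + b - c] epochs, truncated at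
    zero ([observed_wait_window]).  Since [D_k - A_k] is positive, coherence for
    a single customer already forces [b = c], so that the observed number in
    system is [L(tau + b)]: the actual process, read [b] steps ahead, where [b]
    is 0 or 1.  Shifting a sequence by one step changes each partial frequency
    over [tau] steps by at most [1 / tau], hence leaves long-run frequencies
    unchanged ([long_run_frequencies_shift]), and limits are unique. *)

(** Two integers that differ in the strict order differ by at least 1, which
    leaves room for the offsets of the instant and of the epoch.  The premises
    are stated in [R] so that, offsets being explicit, they are linear. *)
Lemma lt_instantE (R : realType) (z' u : R) (z t c : nat) :
  (z%:R + 1 <= t%:R + c%:R :> R -> z' < u) ->
  (t%:R + c%:R <= z%:R :> R -> u <= z') ->
  (z' < u) = (z < t + c)%N.
Proof.
move=> lt_u le_u; case: (ltnP z (t + c)) => h.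
  by apply: lt_u; rewrite -natrD natr1 ler_nat.
by apply/negbTE; rewrite -leNgt le_u// -natrD ler_nat.
Qed.

(** The bound [b <= 1] ensures that the first epoch at which the customer is
    seen, [a + 1 - b], is not negative: a count that starts at [tau = 0] then
    misses nothing. *)
Lemma arrival_observed (R : realType) (eps : R) (r : scheduling_rule)
    (o : observation_epoch) : 0 < eps < 8^-1 ->
  exists2 b : nat, (b <= 1)%N & forall (a : nat) (a' : R) (t : nat),
    scheduled_arrival eps r a%:R a' -> (a' < epoch eps r o t) = (a < t + b)%N.
Proof.
move=> /andP[eps0 eps8].
by case: r; case: o;
  first [ exists 0%N => // a a' t /andP[lo hi]; apply: lt_instantE => h;
          move: lo hi h; rewrite /epoch /instant_mm /instant_m /instant_p;
          move=> lo hi h; lra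
        | exists 1%N => // a a' t /andP[lo hi]; apply: lt_instantE => h;
          move: lo hi h; rewrite /epoch /instant_mm /instant_m /instant_p;
          move=> lo hi h; lra ].
Qed.

(** The value [c = 2] does occur: under LAS-IA the customer leaves before
    [(D_k - 1)^+], so an observer at the epochs [tau^+] last sees him at
    [tau = D_k - 2]. *)
Lemma departure_observed (R : realType) (eps : R) (r : scheduling_rule)
    (o : observation_epoch) : 0 < eps < 8^-1 ->
  exists2 c : nat, (c <= 2)%N & forall (d : nat) (d' : R) (t : nat),
    scheduled_departure eps r d%:R d' ->
    (epoch eps r o t <= d') = (t + c <= d)%N.
Proof.
move=> /andP[eps0 eps8].
suff [c c2 H] : exists2 c : nat, (c <= 2)%N & forall (d : nat) (d' : R) t,
    scheduled_departure eps r d%:R d' ->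
    (d' < epoch eps r o t) = (d < t + c)%N.
  by exists c => // d d' t /H; rewrite leNgt => ->; rewrite -leqNgt.
by case: r; case: o;
  first [ exists 0%N => // a a' t /andP[lo hi]; apply: lt_instantE => h;
          move: lo hi h; rewrite /epoch /instant_mm /instant_m /instant_p;
          move=> lo hi h; lra
        | exists 1%N => // a a' t /andP[lo hi]; apply: lt_instantE => h;
          move: lo hi h; rewrite /epoch /instant_mm /instant_m /instant_p;
          move=> lo hi h; lra
        | exists 2%N => // a a' t /andP[lo hi]; apply: lt_instantE => h;
          move: lo hi h; rewrite /epoch /instant_mm /instant_m /instant_p;
          move=> lo hi h; lra ].
Qed.

Lemma nneseries_interval (R : realType) (m n : nat) :
  (\sum_(0 <= t <oo) (((m <= t < n)%N)%:R : R)%:E = ((n - m)%N%:R : R)%:E)%E.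
Proof.
rewrite (nneseries_split 0 n) => [|k _]; last by rewrite lee_fin.
rewrite add0n (@eseries0 _ _ n) => [|k nk _]; last by rewrite ltnNge nk andbF.
rewrite adde0 sumEFin -natr_sum; congr (_%:R%:E).
rewrite -[RHS]muln1 -sum_nat_const_nat.
rewrite (big_nat_widenl m 0)//= [RHS]big_mkcond big_nat_cond [RHS]big_nat_cond.
by apply: eq_bigr => i /andP[/andP[_ ->] _]; rewrite andbT; case: ifP.
Qed.

(** The epochs at which the customer is seen are the consecutive integers from
    [a + 1 - b] to [d - c]; the two bounds on [b] and [c] keep the truncated
    subtractions in this count faithful. *)
Lemma observed_wait_window (R : realType) (u A' D' : nat -> R)
    (k a d b c : nat) : (b <= 1)%N -> (c <= d.+1)%N ->
  (forall t, (A' k < u t) = (a < t + b)%N) ->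
  (forall t, (u t <= D' k) = (t + c <= d)%N) ->
  observed_wait u A' D' k = ((d + b - (a + c))%N%:R)%:E.
Proof.
move=> b1 cd uA uD; rewrite /observed_wait.
under eq_eseriesr => t _ do rewrite uA uD.
have win t : ((a < t + b) && (t + c <= d) = (a.+1 - b <= t < d.+1 - c))%N by lia.
under eq_eseriesr => t _ do rewrite win.
by rewrite nneseries_interval; congr (_%:R%:E); lia.
Qed.

Lemma cvg_invn (R : realType) : (fun t : nat => t%:R^-1 : R) @ \oo --> (0 : R).
Proof. by rewrite -cvg_shiftS; exact: cvg_harmonic. Qed.

(** After the shift, the sum loses its first term and gains one last term. *)
Lemma frequency_shift (R : realType) (L : nat -> \bar R) (n t : nat) :
  frequency (fun j => L j.+1) n t =
  frequency L n t + t%:R^-1 * ((L t.+1 == n%:R%:E)%:R - (L 1%N == n%:R%:E)%:R).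
Proof.
rewrite /frequency -mulrDr; congr (_ * _).
pose e j : R := (L j == n%:R%:E)%:R.
have := @big_ltn R 0 +%R 1 t.+2 e isT; rewrite big_nat_recr//=.
rewrite (big_add1 _ _ 1)/= => /(canLR (addKr _)) <-.
by rewrite [LHS]addrC [RHS]addrA.
Qed.

Lemma long_run_frequencies_shift (R : realType) (L : nat -> \bar R)
    (p : nat -> R) :
  long_run_frequencies L p -> long_run_frequencies (fun j => L j.+1) p.
Proof.
move=> Lp n; under eq_cvg do rewrite frequency_shift.
rewrite -[p n]addr0; apply: cvgD; first exact: Lp.
apply/norm_cvg0P; apply: (@squeeze_cvgr _ _ _ _ (fun=> 0) (fun t => t%:R^-1)).
- near=> t; rewrite normr_ge0/= normrM ger0_norm ?invr_ge0//.
  rewrite ler_piMr ?invr_ge0//.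
  by case: (_ == _); case: (_ == _);
    rewrite ?subrr ?subr0 ?sub0r ?normrN ?normr1 ?normr0.
- exact: cvg_cst.
- exact: cvg_invn.
Unshelve. all: by end_near. Qed.

Theorem theorem3p5 (R : realType) (eps : R) (Heps : 0 < eps < 8^-1)
  (A D : nat -> nat) (HAD : arrival_departure_path A D)
  (r : scheduling_rule) (o : observation_epoch)
  (A' D' : nat -> R) (Hsched : scheduled eps r A D A' D')
  (Hcoh : coherent (epoch eps r o) A D A' D')
  (p' p : nat -> R)
  (Hp' : long_run_frequencies (observed_number (epoch eps r o) A' D') p')
  (Hp : long_run_frequencies (actual_number A D) p)
  (Hproper : proper_distribution p) :
  forall n : nat, p' n = p n.
Proof.
have [b b1 seenA] := @arrival_observed R eps r o Heps.
have [c c2 seenD] := @departure_observed R eps r o Heps.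
have uA k t : (1 <= k)%N -> (A' k < epoch eps r o t) = (A k < t + b)%N.
  by move=> k1; apply: seenA; case: (Hsched k k1).
have uD k t : (1 <= k)%N -> (epoch eps r o t <= D' k) = (t + c <= D k)%N.
  by move=> k1; apply: seenD; case: (Hsched k k1).
(* One customer is enough, provided that the wait is positive: a zero wait
   would only give [b <= c]. *)
have bc : c = b.
  have AD1 : (A 1 + 1 <= D 1)%N by case: HAD => _ _; apply.
  have := Hcoh 1%N isT.
  rewrite (@observed_wait_window _ _ _ _ _ (A 1%N) (D 1%N) b c)//; first last.
  - by move=> t; exact: uD.
  - by move=> t; exact: uA.
  - by lia.
  rewrite /actual_wait -natrB; last by lia.
  by move=> [/eqP]; rewrite eqr_nat => /eqP; lia.
have obsE t :
    observed_number (epoch eps r o) A' D' t = actual_number A D (t + b).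
  rewrite /observed_number /actual_number /number_in_system.
  congr (counting _); apply/funext => k; apply/propext.
  by split=> -[k1 seen]; split=> //; move: seen;
    rewrite uA// uD// bc ltr_nat ler_nat.
have {}Hp' : long_run_frequencies (fun t => actual_number A D (t + b)) p'.
  by rewrite (_ : (fun _ => _) = observed_number (epoch eps r o) A' D')//;
    apply/funext => t; rewrite obsE.
have Hpb : long_run_frequencies (fun t => actual_number A D (t + b)) p.
  have [b0|{}b1] : b = 0%N \/ b = 1%N by lia.
    by rewrite (_ : (fun _ => _) = actual_number A D)//;
      apply/funext => t; rewrite b0 addn0.
  rewrite (_ : (fun _ => _) = (fun t => actual_number A D t.+1)).
    exact: long_run_frequencies_shift.
  by apply/funext => t; rewrite b1 addn1.
by move=> n; exact: (cvg_unique _ (Hp' n) (Hpb n)).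
Qed.
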